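(* Let $\mathbf P_0,\mathbf P_1\in\mathbb C$, let $\mathbf t_0,\mathbf t_1\in\mathbb C$ with $|\mathbf t_0|=|\mathbf t_1|=1$, and let $\kappa_0,\kappa_1\in\mathbb R$. Then a planar PH biarc of degree $7$ that interpolates the $G^2$ data is given in closed form, depending on four free real parameters $\alpha_0,\alpha_1,\beta_0,\beta_1$ (with $\alpha_0,\alpha_1\neq 0$) and on a sign $\zeta_{\mathbf d}\in\{-1,1\}$, as follows. For every such choice of parameters and sign, put $\Delta\mathbf P_0=\mathbf P_1-\mathbf P_0$, $\mathbf n_\ell=\mathrm i\,\mathbf t_\ell$ for $\ell=0,1$, $$\mathbf w_{A,0}=\alpha_0\,\boldsymbol\chi(\mathbf t_0),\qquad \mathbf w_{B,3}=\alpha_1\,\boldsymbol\chi(\mathbf t_1),$$ $$\mathbf w_{A,1}=\frac{1}{\mathbf w_{A,0}}\Big(\big(\alpha_0^2+\tfrac{\beta_0}{12}\big)\mathbf t_0+\kappa_0\tfrac{\alpha_0^4}{12}\mathbf n_0\Big),\qquad \mathbf w_{B,2}=\frac{1}{\mathbf w_{B,3}}\Big(\big(\alpha_1^2-\tfrac{\beta_1}{12}\big)\mathbf t_1-\kappa_1\tfrac{\alpha_1^4}{12}\mathbf n_1\Big),$$ $$\mathbf U=\tfrac1{52}\big(5(\mathbf w_{A,0}+\mathbf w_{B,3})+39(\mathbf w_{A,1}+\mathbf w_{B,2})\big),$$ $$\mathbf V=\tfrac1{52}\big(40(\mathbf w_{A,0}^2+\mathbf w_{B,3}^2)+49(\mathbf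 w_{A,0}\mathbf w_{A,1}+\mathbf w_{B,2}\mathbf w_{B,3})+62(\mathbf w_{A,1}^2+\mathbf w_{B,2}^2)+\mathbf w_{A,0}\mathbf w_{B,2}+\mathbf w_{A,1}\mathbf w_{B,3}+28\,\mathbf w_{A,1}\mathbf w_{B,2}-560\,\Delta\mathbf P_0\big),$$ $$\mathbf d=\zeta_{\mathbf d}\,\boldsymbol\chi(\mathbf U^2-\mathbf V)-\mathbf U,$$ $$\mathbf w_{A,2}=\tfrac12(\mathbf w_{A,1}+\mathbf d),\qquad \mathbf w_{B,1}=\tfrac12(\mathbf w_{B,2}+\mathbf d),\qquad \mathbf w_{A,3}=\mathbf w_{B,0}=\tfrac14\mathbf w_{A,1}+\tfrac12\mathbf d+\tfrac14\mathbf w_{B,2}.$$ Then the curve $\mathbf r$ with preimage coefficients $\mathbf w_{A,i},\mathbf w_{B,i}$, $i=0,1,2,3$, and with integration constants fixed by $\mathbf r_A(0)=\mathbf P_0$, $\mathbf r_B(1)=\mathbf P_1$, is a PH biarc of degree $7$ and satisfies $$\mathbf r(\ell)=\mathbf P_\ell,\qquad \frac{\mathbf r'(\ell)}{|\mathbf r'(\ell)|}=\mathbf t_\ell,\qquad \kappa(\ell)=\kappa_\ell,\qquad \ell=0,1,$$ where $\kappa$ is the signed curvature of $\mathbf r$.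
   Context: The plane $\mathbb R^2$ is identified with $\mathbb C$, and $\mathrm i$ is the imaginary unit. $B_i^n(t)=\binom{n}{i}(1-t)^{n-i}t^i$ are the Bernstein polynomials. For $\mathbf c=c_1+\mathrm i\,c_2\in\mathbb C$, $\boldsymbol\chi(\mathbf c)$ denotes the square root of $\mathbf c$ given by $$\boldsymbol\chi(\mathbf c)=\frac{\sqrt2}{2}\Big(\sqrt{|\mathbf c|+c_1}+\mathrm i\,\frac{c_2}{\sqrt{|\mathbf c|+c_1}}\Big)$$ when $|\mathbf c|+c_1\ne0$, and $\boldsymbol\chi(\mathbf c)=\mathrm i\sqrt{|\mathbf c|}$ when $\mathbf c$ is real and $\le0$. Thus $\boldsymbol\chi(\mathbf c)^2=\mathbf c$ always. PH biarc of degree $7$: given complex coefficients $\mathbf w_{A,i},\mathbf w_{B,i}$, $i=0,\dots,3$, let $$\mathbf w_A(t)=\sum_{i=0}^3\mathbf w_{A,i}B_i^3(2t)\ \ (t\in[0,\tfrac12]),\qquad \mathbf w_B(t)=\sum_{i=0}^3\mathbf w_{B,i}B_i^3(2t-1)\ \ (t\in[\tfrac12,1])$$ (the preimage). Let $\mathbf r_A,\mathbf r_B$ be polynomial curves (of formal degree $7$) with $\mathbf r_A'(t)=\mathbf w_A(t)^2$ and $\mathbf r_B'(t)=\mathbf w_B(t)^2$. The piecewise curve $\mathbf r:[0,1]\to\mathbb C$ equal to $\mathbf r_A$ on $[0,\frac12)$ and to $\mathbf r_B$ on $[\frac12,1]$ is called a PH biarc of degree $7$ here when the preimage is $C^2$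 at $t=\frac12$ (i.e. $\mathbf w_A^{(k)}(\frac12)=\mathbf w_B^{(k)}(\frac12)$ for $k=0,1,2$) and $\mathbf r_A(\frac12)=\mathbf r_B(\frac12)$. The signed curvature at a parameter value where $\mathbf r'\ne0$ is $\kappa=\mathrm{Im}(\overline{\mathbf r'}\,\mathbf r'')/|\mathbf r'|^3$. *)

(* Defs.v *)
From Stdlib Require Export Reals List.
From Coquelicot Require Export Coquelicot.
Export ListNotations.

Open Scope C_scope.

(* [Cmod c + Re c = 0] holds exactly when c is real and nonpositive. *)
Definition chi (c : C) : C :=
  if Req_EM_T (Cmod c + Re c) 0
  then Ci * RtoC (sqrt (Cmod c))
  else RtoC (sqrt 2 / 2) *
       (RtoC (sqrt (Cmod c + Re c)) + Ci * RtoC (Im c / sqrt (Cmod c + Re c))).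

Definition bernstein (n i : nat) (t : R) : R :=
  (Binomial.C n i * (1 - t) ^ (n - i) * t ^ i)%R.

Definition bernstein_sum (n : nat) (c : nat -> C) (t : R) : C :=
  sum_n (fun i => c i * RtoC (bernstein n i t)) n.

(* Bernstein polynomials and derivatives are taken on all of R, so that
   two-sided derivatives at 0, 1/2 and 1 of a polynomial piece are the
   one-sided ones of its restriction to [0,1/2] or [1/2,1]. *)
Definition preimageA (wA : nat -> C) (t : R) : C := bernstein_sum 3 wA (2 * t).
Definition preimageB (wB : nat -> C) (t : R) : C := bernstein_sum 3 wB (2 * t - 1).

Definition quad (a b c d : C) (i : nat) : C := nth i [a; b; c; d] (RtoC 0).

(* [Derive_n] is total; it is only used below at points where the curve is
   smooth (polynomial near the point). *)
Definition CDerive_n (f : R -> C) (k : nat) (t : R) : C :=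
  (Derive_n (fun s => Re (f s)) k t, Derive_n (fun s => Im (f s)) k t).

Definition polynomial_curve (n : nat) (f : R -> C) : Prop :=
  exists c : nat -> C, forall t : R, f t = sum_n (fun i => c i * RtoC (t ^ i)) n.

Definition PH_pieces7 (wA wB : nat -> C) (rA rB : R -> C) : Prop :=
  polynomial_curve 7 rA /\ polynomial_curve 7 rB /\
  (forall t : R, (0 <= t <= 1 / 2)%R ->
     is_derive (V := C_R_NormedModule) rA t (preimageA wA t ^ 2)) /\
  (forall t : R, (1 / 2 <= t <= 1)%R ->
     is_derive (V := C_R_NormedModule) rB t (preimageB wB t ^ 2)).

Definition PH_biarc7 (wA wB : nat -> C) (rA rB : R -> C) : Prop :=
  PH_pieces7 wA wB rA rB /\
  (forall k : nat, (k <= 2)%nat ->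
     CDerive_n (preimageA wA) k (1 / 2) = CDerive_n (preimageB wB) k (1 / 2)) /\
  rA (1 / 2)%R = rB (1 / 2)%R.

(* The curve on [0,1]; outside it continues with the polynomial of the adjacent
   piece, so its derivatives at 0 and 1 are the one-sided ones from [0,1]. *)
Definition biarc (rA rB : R -> C) (t : R) : C :=
  if Rlt_dec t (1 / 2) then rA t else rB t.

Definition signed_curvature (r : R -> C) (t : R) : R :=
  (Im (Cconj (CDerive_n r 1 t) * CDerive_n r 2 t)%C / Cmod (CDerive_n r 1 t) ^ 3)%R.

(* Main.v *)
Require Import Defs.
From Stdlib Require Import Lra Lia.

(** On either half of the parameter interval the preimage is a complex cubic
    [w], the hodograph is [w ^ 2], and the theorem comes down to three
    independent computations with Bernstein coefficients.

    _The ends._  At an end of the interval, [r' = w ^ 2] and [r'' = 2 w w'], and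
    the end values of [w] and [w'] are read off the two outermost coefficients.
    At 0 this gives [r' = w0 ^ 2] and [r'' = 12 (w0 w1 - w0 ^ 2)].  Since the
    chosen [w0] is [alpha0] times a square root of [t0], and [w0 w1] is
    prescribed, [r'] is [alpha0 ^ 2 t0] and [r''] is
    [beta0 t0 + kappa0 alpha0 ^ 4 n0]: the tangential part [beta0] is free and
    the normal part is exactly what curvature [kappa0] demands
    ([derivatives_at_start], [derivatives_at_end], [tangent_curvature]).

    _The joint._  The three C2 conditions at 1/2 are linear in the coefficients.
    Writing [d] for the common value of [2 wA2 - wA1] and [2 wB1 - wB2], which
    the second derivative forces to agree, the formulas for the inner
    coefficients are their general solution ([preimage_C2]).

    _The gap._  What remains is continuity of the curve itself: the integrals of
    the two hodographs must add up to [P1 - P0].  Each integral is a quadratic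
    form in the coefficients ([piece_displacement]), and the sum of the two,
    minus [P1 - P0], is a constant multiple of [d ^ 2 + 2 U d + V].  So [d] has
    to be a root of a complex quadratic equation, which the formula with [chi]
    solves because [chi] is a square root ([chi_sqr], [quadratic_root]).

    The pieces are only assumed to be polynomial curves whose derivative is
    [w ^ 2] on their half of the interval.  The displacement follows by comparing
    with an explicit primitive.  The second derivative at an end is that of a
    two-sided extension; it is still governed by [w] because two differentiable
    functions that agree on a segment have the same derivative at its end points
    ([Cderive_agree_eq]). *)

(** * The square root *)

Lemma Cmod_add_Re_nonneg (c : C) : (0 <= Cmod c + Re c)%R.
Proof.
  pose proof (re_le_Cmod c) as H. apply Rabs_le_between in H. lra.
Qed.

(** The real part of the square is [(m - (Im c)^2 / m) / 2] with
    [m = Cmod c + Re c], and [(Im c)^2 = m (Cmod c - Re c)].  When [m = 0] the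
    imaginary part vanishes and [c = - Cmod c]. *)
Lemma chi_sqr (c : C) : chi c ^ 2 = c.
Proof.
  assert (Hm : (Cmod c * Cmod c = Re c * Re c + Im c * Im c)%R)
    by (pose proof (Cmod2_alt c); lra).
  pose proof (Cmod_ge_0 c) as Hc0. pose proof (Cmod_add_Re_nonneg c) as Hs0.
  unfold chi; destruct c as [a b]; cbn [Re Im fst snd] in *.
  destruct (Req_EM_T _ _) as [E|E].
  - assert (b = 0)%R by nra. subst b.
    pose proof (sqrt_sqrt _ Hc0) as Hq.
    apply injective_projections; cbn; nra.
  - set (m := (Cmod (a, b) + a)%R) in *.
    pose proof (sqrt_sqrt 2 ltac:(lra)) as H2. pose proof (sqrt_sqrt m Hs0) as Hq.
    assert (Hs : sqrt m <> 0%R) by (intro Z; rewrite Z in Hq; lra).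
    set (s := sqrt m) in *. set (q := sqrt 2) in *.
    assert (Hb : (b * b = m * (m - 2 * a))%R) by (subst m; nra).
    apply injective_projections; cbn.
    + transitivity ((q * q) / 4 * (s * s - (b * b) / (s * s)))%R; [field; exact Hs|].
      rewrite H2, Hq, Hb. field. exact E.
    + transitivity ((q * q) / 2 * b)%R; [field; exact Hs|]. rewrite H2. field.
Qed.

Lemma scaled_chi_sqr (a : R) (c : C) : (RtoC a * chi c) ^ 2 = RtoC (a ^ 2) * c.
Proof.
  transitivity (RtoC a ^ 2 * chi c ^ 2); [ring|]. now rewrite chi_sqr, RtoC_pow.
Qed.

Lemma chi_neq_0 (c : C) : c <> 0 -> chi c <> 0.
Proof.
  intros Hc Z. apply Hc. rewrite <- (chi_sqr c), Z. ring.
Qed.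

(** Completing the square: both signs give a root. *)
Lemma quadratic_root (U V : C) (zeta : R) :
  zeta = 1%R \/ zeta = (-1)%R ->
  let d := RtoC zeta * chi (U ^ 2 - V) - U in d ^ 2 + 2 * U * d + V = 0.
Proof.
  intros Hz d. unfold d.
  transitivity (RtoC (zeta ^ 2) * chi (U ^ 2 - V) ^ 2 - U ^ 2 + V).
  - rewrite RtoC_pow. ring.
  - rewrite chi_sqr. replace (zeta ^ 2)%R with 1%R by (destruct Hz; subst; ring). ring.
Qed.

(** * Differentiation of complex-valued functions of a real variable *)

Notation Cderive f t l := (is_derive (V := C_R_NormedModule) f t l).

Lemma Cderive_components (f : R -> C) (t : R) (l : C) :
  Cderive f t l ->
  is_derive (fun s => Re (f s)) t (Re l) /\ is_derive (fun s => Im (f s)) t (Im l).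
Proof.
  intros H; split.
  - apply (filterdiff_comp' f (fun z : C_R_NormedModule => fst z : R) t _ fst H).
    apply filterdiff_linear, is_linear_fst.
  - apply (filterdiff_comp' f (fun z : C_R_NormedModule => snd z : R) t _ snd H).
    apply filterdiff_linear, is_linear_snd.
Qed.

Lemma Cderive_of_components (f : R -> C) (t : R) (l : C) :
  is_derive (fun s => Re (f s)) t (Re l) -> is_derive (fun s => Im (f s)) t (Im l) ->
  Cderive f t l.
Proof.
  intros H1 H2.
  apply (is_derive_ext (V := C_R_NormedModule)
    (fun s => plus (scal (Re (f s)) (RtoC 1 : C_R_NormedModule))
                   (scal (Im (f s)) (Ci : C_R_NormedModule)))).
  { intros s. apply injective_projections; cbn; unfold plus, scal, mult; cbn;
    unfold mult; cbn; unfold Re, Im; ring. }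
  replace (l : C_R_NormedModule)
    with (plus (scal (Re l) (RtoC 1 : C_R_NormedModule)) (scal (Im l) (Ci : C_R_NormedModule))).
  - apply (is_derive_plus (V := C_R_NormedModule));
      now apply (is_derive_scal_l (V := C_R_NormedModule)).
  - apply injective_projections; cbn; unfold plus, scal, mult; cbn;
    unfold mult; cbn; unfold Re, Im; ring.
Qed.

Lemma Cderive_sqr (f : R -> C) (t : R) (l : C) :
  Cderive f t l -> Cderive (fun s => f s ^ 2) t (2 * f t * l).
Proof.
  intros H. destruct (Cderive_components _ _ _ H) as [H1 H2].
  apply Cderive_of_components.
  - apply (is_derive_ext (fun s => (Re (f s) * Re (f s) - Im (f s) * Im (f s))%R)).
    { intros s. cbn. unfold Re, Im. ring. }
    evar_last.
    + apply (is_derive_minus (V := R_NormedModule));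
        apply (is_derive_mult (K := R_AbsRing)); eauto using Rmult_comm.
    + cbn; unfold minus, plus, opp, mult; cbn. unfold Re, Im. ring.
  - apply (is_derive_ext (fun s => (2 * (Re (f s) * Im (f s)))%R)).
    { intros s. cbn. unfold Re, Im. ring. }
    evar_last.
    + apply is_derive_scal;
        apply (is_derive_mult (K := R_AbsRing)); eauto using Rmult_comm.
    + cbn; unfold minus, plus, opp, mult; cbn. unfold Re, Im. ring.
Qed.

Lemma CDerive_n_S (f g : R -> C) (k : nat) (t : R) :
  (forall s, Cderive f s (g s)) -> CDerive_n f (S k) t = CDerive_n g k t.
Proof.
  intros H. unfold CDerive_n.
  f_equal; rewrite <- (Nat.add_1_r k), <- Derive_n_comp; apply Derive_n_ext;
    intros s; apply is_derive_unique, (Cderive_components _ _ _ (H s)).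
Qed.

Lemma CDerive_n_0 (f : R -> C) (t : R) : CDerive_n f 0 t = f t.
Proof. symmetry; apply surjective_pairing. Qed.

Lemma CDerive_n_ext_loc (f g : R -> C) (k : nat) (t : R) :
  locally t (fun s => f s = g s) -> CDerive_n f k t = CDerive_n g k t.
Proof.
  intros H. unfold CDerive_n.
  f_equal; apply Derive_n_ext_loc; revert H; apply filter_imp; now intros s ->.
Qed.

(** One-sided uniqueness of the derivative: [f - g] vanishes on the segment, so
    the difference quotients of its two components at [x] are zero along steps
    that stay inside. *)
Lemma Cderive_agree_eq (f g : R -> C) (a b x : R) (lf lg : C) :
  (a < b)%R -> (a <= x <= b)%R -> (forall t, (a <= t <= b)%R -> f t = g t) ->
  Cderive f x lf -> Cderive g x lg -> lf = lg.
Proof.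
  intros Hab Hx Hfg Hf Hg.
  assert (Hreal : forall (h : R -> R) (l : R), is_derive h x l ->
            (forall t, (a <= t <= b)%R -> h t = 0%R) -> l = 0%R).
  { intros h l Hh Hz. apply is_derive_Reals in Hh.
    destruct (Req_dec l 0) as [|Hl]; [assumption|exfalso].
    destruct (Hh (Rabs l)) as [[eta Heta] Hd]; [now apply Rabs_pos_lt|]. cbn in Hd.
    (* A step of half the smaller of [eta] and [b - a], towards the farther end
       of the segment, stays in the segment. *)
    assert (Hstep : exists u, u <> 0%R /\ (Rabs u < eta)%R /\ (a <= x + u <= b)%R).
    { pose proof (Rmin_glb_lt eta (b - a) 0 Heta ltac:(lra)) as Hp.
      pose proof (Rmin_l eta (b - a)) as Hl1. pose proof (Rmin_r eta (b - a)) as Hl2.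
      set (e := Rmin eta (b - a)) in *.
      destruct (Rle_dec x ((a + b) / 2)).
      - exists (e / 2)%R. rewrite Rabs_pos_eq by lra. lra.
      - exists (- (e / 2))%R. rewrite Rabs_Ropp, Rabs_pos_eq by lra. lra. }
    destruct Hstep as (u & Hu0 & Hu & Hxu).
    specialize (Hd u Hu0 Hu). rewrite !Hz in Hd by assumption.
    replace ((0 - 0) / u - l)%R with (- l)%R in Hd by (field; exact Hu0).
    rewrite Rabs_Ropp in Hd. lra. }
  destruct (Cderive_components _ _ _ Hf) as [F1 F2].
  destruct (Cderive_components _ _ _ Hg) as [G1 G2].
  apply injective_projections; apply Rminus_diag_uniq; eapply Hreal.
  - apply (is_derive_minus (V := R_NormedModule) _ _ _ _ _ F1 G1).
  - intros t Ht; cbv beta; rewrite (Hfg t Ht). apply Rminus_diag_eq; reflexivity.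
  - apply (is_derive_minus (V := R_NormedModule) _ _ _ _ _ F2 G2).
  - intros t Ht; cbv beta; rewrite (Hfg t Ht). apply Rminus_diag_eq; reflexivity.
Qed.

Lemma Cderive_eq_displacement (f r s : R -> C) (a b : R) :
  (a < b)%R ->
  (forall t, (a <= t <= b)%R -> Cderive r t (f t)) ->
  (forall t, (a <= t <= b)%R -> Cderive s t (f t)) ->
  r b - r a = s b - s a.
Proof.
  intros Hab Hr Hs.
  assert (E : r a - s a = r b - s b).
  { apply (eq_is_derive (V := C_R_NormedModule) (fun t => minus (r t : C_R_NormedModule) (s t)));
      [|exact Hab].
    intros t Ht. evar_last.
    - apply (is_derive_minus (V := C_R_NormedModule)); auto.
    - apply (minus_eq_zero (G := C_R_NormedModule)). }
  replace (r b) with (r b - s b + s b) by ring. rewrite <- E. ring.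
Qed.

(** * Polynomial curves in the power basis *)

Definition power_curve (n : nat) (c : nat -> C) (t : R) : C :=
  sum_n (fun i => c i * RtoC (t ^ i)) n.

Lemma Cderive_monomial (c : C) (i : nat) (t : R) :
  Cderive (fun s => c * RtoC (s ^ i)) t (RtoC (INR i * t ^ pred i) * c).
Proof.
  apply (is_derive_ext (V := C_R_NormedModule) (fun s => scal (s ^ i)%R (c : C_R_NormedModule))).
  { intros s. rewrite scal_R_Cmult. apply Cmult_comm. }
  rewrite <- scal_R_Cmult.
  apply (is_derive_scal_l (V := C_R_NormedModule) (fun s => s ^ i)%R).
  auto_derive; trivial; ring.
Qed.

Lemma Cderive_power_curve (n : nat) (c : nat -> C) (t : R) :
  Cderive (power_curve (S n) c) t
    (power_curve n (fun i => RtoC (INR (S i)) * c (S i)) t).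
Proof.
  assert (E : power_curve n (fun i => RtoC (INR (S i)) * c (S i)) t
     = sum_n (fun i => RtoC (INR i * t ^ pred i) * c i) (S n)).
  { unfold power_curve. unfold sum_n at 2. rewrite sum_Sn_m by lia.
    rewrite <- sum_n_m_S. change (INR 0) with 0%R. rewrite Rmult_0_l.
    rewrite Cmult_0_l. etransitivity; [|symmetry; apply Cplus_0_l]. apply sum_n_ext. intros i.
    rewrite RtoC_mult. cbn [pred].
    match goal with |- ?x = ?y => change (@eq C x y) end. ring. }
  rewrite E.
  apply (is_derive_sum_n (V := C_R_NormedModule) (fun i s => c i * RtoC (s ^ i))).
  intros i _. apply Cderive_monomial.
Qed.

Lemma polynomial_curve_Cderive (n : nat) (r : R -> C) :
  polynomial_curve (S n) r ->
  exists r', polynomial_curve n r' /\ forall t, Cderive r t (r' t).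
Proof.
  intros [c Hc]. exists (power_curve n (fun i => RtoC (INR (S i)) * c (S i))). split.
  - eexists; reflexivity.
  - intros t. apply (is_derive_ext (power_curve (S n) c)).
    + intros s; symmetry; apply Hc.
    + apply Cderive_power_curve.
Qed.

Lemma polynomial_curve_primitive (n : nat) (f : R -> C) (x : R) (P : C) :
  polynomial_curve n f ->
  exists F, polynomial_curve (S n) F /\ F x = P /\ forall t, Cderive F t (f t).
Proof.
  intros [c Hc].
  (* The coefficients of the primitive with constant term [K]. *)
  set (p K := fun i => match i with O => K | S j => c j / RtoC (INR (S j)) end).
  assert (HK : forall K t, power_curve (S n) (p K) t = K + power_curve (S n) (p 0) t).
  { intros K t. unfold power_curve, sum_n. rewrite 2!(sum_Sn_m _ 0) by lia.
    cbn [p]. rewrite (sum_n_m_ext_loc (fun i => p K i * RtoC (t ^ i))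
      (fun i => p 0 i * RtoC (t ^ i)) 1 (S n)) by (intros [|k] Hk; [lia|reflexivity]).
    match goal with |- plus ?u ?v = K + plus ?w ?v =>
      change (u + v = K + (w + v)) end.
    cbn [pow]. ring. }
  exists (power_curve (S n) (p (P - power_curve (S n) (p 0) x))).
  split; [|split].
  - eexists; reflexivity.
  - rewrite HK. ring.
  - intros t.
    replace (f t) with (power_curve n
      (fun i => RtoC (INR (S i)) * p (P - power_curve (S n) (p 0) x) (S i)) t).
    + apply Cderive_power_curve.
    + rewrite Hc. apply sum_n_ext; intros i. cbn [p].
      match goal with |- ?x = ?y => change (@eq C x y) end. field.
      intro Z. apply RtoC_inj in Z. revert Z. apply not_0_INR. lia.
Qed.

(** * Cubic preimages in Bernstein form *)

Ltac bernstein_expand :=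
  unfold bernstein_sum, bernstein; rewrite !sum_Sn, sum_O;
  repeat match goal with |- context [Binomial.C ?n ?k] =>
    let b := eval compute in
      (Z.of_nat (Factorial.fact n / (Factorial.fact k * Factorial.fact (n - k)))) in
    replace (Binomial.C n k) with (IZR b) by (unfold Binomial.C; cbn; field)
  end;
  cbn [Nat.sub];
  rewrite !RtoC_mult, !RtoC_pow, !RtoC_minus; change plus with Cplus; ring.

Lemma bernstein_sum_3 (w : nat -> C) (t : R) :
  bernstein_sum 3 w t = w 0%nat * (1 - t) ^ 3 + 3 * w 1%nat * (1 - t) ^ 2 * t
                        + 3 * w 2%nat * (1 - t) * t ^ 2 + w 3%nat * t ^ 3.
Proof. bernstein_expand. Qed.

Lemma bernstein_sum_2 (w : nat -> C) (t : R) :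
  bernstein_sum 2 w t = w 0%nat * (1 - t) ^ 2 + 2 * w 1%nat * (1 - t) * t
                        + w 2%nat * t ^ 2.
Proof. bernstein_expand. Qed.

Lemma bernstein_sum_1 (w : nat -> C) (t : R) :
  bernstein_sum 1 w t = w 0%nat * (1 - t) + w 1%nat * t.
Proof. bernstein_expand. Qed.

(** [m = 0] gives the preimage on [[0, 1/2]] and [m = 1] the one on
    [[1/2, 1]]; the domain is [[m/2, (m+1)/2]] in both cases. *)
Definition piece (w : nat -> C) (m t : R) : C := bernstein_sum 3 w (2 * t - m).

Lemma preimageA_piece w t : preimageA w t = piece w 0 t.
Proof. unfold preimageA, piece. f_equal. ring. Qed.

(** The differentiation rule for Bernstein polynomials: forward differences of
    the coefficients, times the degree, times 2 for the speed of [2 t - m]. *)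
Definition piece' (w : nat -> C) (m t : R) : C :=
  6 * bernstein_sum 2 (fun i => w (S i) - w i) (2 * t - m).

Definition piece'' (w : nat -> C) (m t : R) : C :=
  24 * bernstein_sum 1 (fun i => w (S (S i)) - 2 * w (S i) + w i) (2 * t - m).

(** [d1], [d2], [d3] are the power coefficients in the local parameter
    [s = 2 t - m], that is, forward differences with binomial weights; the
    entries re-expand them in [t]. *)
Definition piece_coef (w : nat -> C) (m : R) : nat -> C :=
  let d1 := 3 * (w 1%nat - w 0%nat) in
  let d2 := 3 * (w 2%nat - 2 * w 1%nat + w 0%nat) in
  let d3 := w 3%nat - 3 * w 2%nat + 3 * w 1%nat - w 0%nat in
  quad (w 0%nat - d1 * m + d2 * m ^ 2 - d3 * m ^ 3)
       (2 * (d1 - 2 * d2 * m + 3 * d3 * m ^ 2)) (4 * (d2 - 3 * d3 * m)) (8 * d3).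

Ltac power_expand :=
  unfold power_curve; rewrite !sum_Sn, !sum_O;
  cbn [nth quad piece_coef Nat.sub]; change plus with Cplus;
  rewrite ?S_INR; change (INR 0) with 0%R;
  rewrite ?RtoC_pow, ?RtoC_minus, ?RtoC_mult, ?RtoC_plus;
  match goal with |- ?x = ?y => change (@eq C x y) end.

Lemma piece_power w m t : piece w m t = power_curve 3 (piece_coef w m) t.
Proof.
  unfold piece. rewrite bernstein_sum_3.
  power_expand. ring.
Qed.

Lemma Cderive_piece w m t : Cderive (piece w m) t (piece' w m t).
Proof.
  apply (is_derive_ext (power_curve 3 (piece_coef w m))).
  { intros s; symmetry; apply piece_power. }
  replace (piece' w m t) with
    (power_curve 2 (fun i => RtoC (INR (S i)) * piece_coef w m (S i)) t).
  { apply Cderive_power_curve. }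
  unfold piece'. rewrite bernstein_sum_2.
  power_expand. ring.
Qed.

Lemma Cderive_piece' w m t : Cderive (piece' w m) t (piece'' w m t).
Proof.
  apply (is_derive_ext (power_curve 2 (fun i => RtoC (INR (S i)) * piece_coef w m (S i)))).
  { intros s. unfold piece'. rewrite bernstein_sum_2.
    power_expand. ring. }
  replace (piece'' w m t) with
    (power_curve 1 (fun i => RtoC (INR (S i)) * (RtoC (INR (S (S i))) * piece_coef w m (S (S i)))) t).
  { apply Cderive_power_curve. }
  unfold piece''. rewrite bernstein_sum_1.
  power_expand. ring.
Qed.

Lemma piece_start w m : piece w m (m / 2) = w 0%nat.
Proof.
  unfold piece. rewrite bernstein_sum_3.
  replace (2 * (m / 2) - m)%R with 0%R by field. ring.
Qed.

Lemma piece_end w m : piece w m ((m + 1) / 2) = w 3%nat.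
Proof.
  unfold piece. rewrite bernstein_sum_3.
  replace (2 * ((m + 1) / 2) - m)%R with 1%R by field. ring.
Qed.

Lemma piece'_start w m : piece' w m (m / 2) = 6 * (w 1%nat - w 0%nat).
Proof.
  unfold piece'. rewrite bernstein_sum_2.
  replace (2 * (m / 2) - m)%R with 0%R by field. ring.
Qed.

Lemma piece'_end w m : piece' w m ((m + 1) / 2) = 6 * (w 3%nat - w 2%nat).
Proof.
  unfold piece'. rewrite bernstein_sum_2.
  replace (2 * ((m + 1) / 2) - m)%R with 1%R by field. ring.
Qed.

Lemma piece''_start w m :
  piece'' w m (m / 2) = 24 * (w 2%nat - 2 * w 1%nat + w 0%nat).
Proof.
  unfold piece''. rewrite bernstein_sum_1.
  replace (2 * (m / 2) - m)%R with 0%R by field. ring.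
Qed.

Lemma piece''_end w m :
  piece'' w m ((m + 1) / 2) = 24 * (w 3%nat - 2 * w 2%nat + w 1%nat).
Proof.
  unfold piece''. rewrite bernstein_sum_1.
  replace (2 * ((m + 1) / 2) - m)%R with 1%R by field. ring.
Qed.

(** * The two pieces of the curve *)

Lemma polynomial_curve_piece_sqr w m : polynomial_curve 6 (fun t => piece w m t ^ 2).
Proof.
  (* The Cauchy product; [quad] is zero beyond index 3. *)
  exists (fun k => sum_n (fun i => piece_coef w m i * piece_coef w m (k - i)%nat) k).
  intros t. rewrite piece_power. unfold piece_coef; cbv zeta.
  generalize (w 0%nat) (w 1%nat) (w 2%nat) (w 3%nat). intros.
  match goal with |- context [quad ?x ?y ?z ?u] =>
    generalize x y z u end. intros.
  power_expand. ring.
Qed.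

(** Half the integral of [(sum_i w_i B_i^3) ^ 2] over [[0, 1]]: the product
    [B_i^3 B_j^3] is [C 3 i * C 3 j / C 6 (i + j)] times a sextic Bernstein
    polynomial, whose integral is 1/7.  The half is the length of the parameter
    interval of a piece. *)
Definition hodograph_integral (w : nat -> C) : C :=
  1 / 14 * (w 0%nat ^ 2 + w 0%nat * w 1%nat
    + (2 * w 0%nat * w 2%nat + 3 * w 1%nat ^ 2) / 5
    + (w 0%nat * w 3%nat + 9 * w 1%nat * w 2%nat) / 10
    + (2 * w 1%nat * w 3%nat + 3 * w 2%nat ^ 2) / 5
    + w 2%nat * w 3%nat + w 3%nat ^ 2).

Lemma piece_displacement w m (r : R -> C) :
  (forall t, (m / 2 <= t <= (m + 1) / 2)%R -> Cderive r t (piece w m t ^ 2)) ->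
  r ((m + 1) / 2)%R - r (m / 2)%R = hodograph_integral w.
Proof.
  intros Hr.
  (* [F] is the termwise primitive of the squared cubic, whose power
     coefficients in [2 t - m] are [c]; the factor 2 in [p] compensates the
     inner derivative. *)
  set (c := quad (w 0%nat) (3 * (w 1%nat - w 0%nat))
                 (3 * (w 2%nat - 2 * w 1%nat + w 0%nat))
                 (w 3%nat - 3 * w 2%nat + 3 * w 1%nat - w 0%nat)).
  set (sq := fun k => sum_n (fun i => c i * c (k - i)%nat) k).
  set (p := fun i => match i with O => RtoC 0
                     | S j => sq j / RtoC (2 * INR (S j)) end).
  set (F := fun t => power_curve 7 p (2 * t - m)).
  rewrite (Cderive_eq_displacement (fun t => piece w m t ^ 2) r F);
    [|lra|exact Hr|].
  - unfold F.
    replace (2 * ((m + 1) / 2) - m)%R with 1%R by field.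
    replace (2 * (m / 2) - m)%R with 0%R by field.
    unfold hodograph_integral, p, sq, c. power_expand. field.
  - intros t _. unfold F.
    evar_last.
    + apply (is_derive_comp (V := C_R_NormedModule) (power_curve 7 p) (fun t => 2 * t - m)%R).
      * apply Cderive_power_curve.
      * auto_derive; [trivial|reflexivity].
    + rewrite scal_R_Cmult. unfold piece. rewrite bernstein_sum_3.
      unfold p, sq, c. power_expand. field.
Qed.

(** [f] stands for the biarc, which near an end coincides with its polynomial
    piece [r].  [r'] is known only on the segment, so [r''] is found by comparing
    the polynomial [r'] with [w ^ 2] there. *)
Lemma piece_curve_derivatives n w m r f x :
  polynomial_curve (S (S n)) r ->
  (forall t, (m / 2 <= t <= (m + 1) / 2)%R -> Cderive r t (piece w m t ^ 2)) ->
  (m / 2 <= x <= (m + 1) / 2)%R ->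
  locally x (fun t => f t = r t) ->
  CDerive_n f 1 x = piece w m x ^ 2 /\
  CDerive_n f 2 x = 2 * piece w m x * piece' w m x.
Proof.
  intros Hpoly Hr Hx Hloc.
  rewrite !(CDerive_n_ext_loc f r) by exact Hloc.
  destruct (polynomial_curve_Cderive _ _ Hpoly) as (r1 & Hpoly1 & Hr1).
  destruct (polynomial_curve_Cderive _ _ Hpoly1) as (r2 & _ & Hr2).
  assert (Hagree : forall t, (m / 2 <= t <= (m + 1) / 2)%R -> r1 t = piece w m t ^ 2).
  { intros t Ht.
    apply (Cderive_agree_eq r r (m / 2) ((m + 1) / 2) t); auto; lra. }
  rewrite !(CDerive_n_S r r1) by exact Hr1.
  rewrite (CDerive_n_S r1 r2), !CDerive_n_0 by exact Hr2.
  split; [now apply Hagree|].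
  apply (Cderive_agree_eq r1 (fun t => piece w m t ^ 2) (m / 2) ((m + 1) / 2) x);
    auto; [lra|]. apply Cderive_sqr, Cderive_piece.
Qed.

Lemma derivatives_at_start n w m r f x :
  x = (m / 2)%R -> polynomial_curve (S (S n)) r ->
  (forall t, (m / 2 <= t <= (m + 1) / 2)%R -> Cderive r t (piece w m t ^ 2)) ->
  locally x (fun t => f t = r t) ->
  CDerive_n f 1 x = w 0%nat ^ 2 /\
  CDerive_n f 2 x = 12 * (w 0%nat * w 1%nat) - 12 * w 0%nat ^ 2.
Proof.
  intros Hx Hpoly Hr Hloc.
  destruct (piece_curve_derivatives n w m r f x Hpoly Hr ltac:(lra) Hloc) as [-> ->].
  rewrite Hx, piece_start, piece'_start. split; ring.
Qed.

Lemma derivatives_at_end n w m r f x :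
  x = ((m + 1) / 2)%R -> polynomial_curve (S (S n)) r ->
  (forall t, (m / 2 <= t <= (m + 1) / 2)%R -> Cderive r t (piece w m t ^ 2)) ->
  locally x (fun t => f t = r t) ->
  CDerive_n f 1 x = w 3%nat ^ 2 /\
  CDerive_n f 2 x = 12 * w 3%nat ^ 2 - 12 * (w 3%nat * w 2%nat).
Proof.
  intros Hx Hpoly Hr Hloc.
  destruct (piece_curve_derivatives n w m r f x Hpoly Hr ltac:(lra) Hloc) as [-> ->].
  rewrite Hx, piece_end, piece'_end. split; ring.
Qed.

(** Only the component of the second derivative normal to [T] enters the
    curvature; [alpha ^ 4] is the squared speed. *)
Lemma tangent_curvature (f : R -> C) (x alpha beta kappa : R) (T : C) :
  Cmod T = 1%R -> alpha <> 0%R ->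
  CDerive_n f 1 x = RtoC (alpha ^ 2) * T ->
  CDerive_n f 2 x = RtoC beta * T + RtoC (kappa * alpha ^ 4) * (Ci * T) ->
  CDerive_n f 1 x / RtoC (Cmod (CDerive_n f 1 x)) = T /\ signed_curvature f x = kappa.
Proof.
  intros HT Ha H1 H2.
  assert (Hm : Cmod (RtoC (alpha ^ 2) * T) = (alpha ^ 2)%R).
  { rewrite Cmod_mult, HT, Cmod_R, Rabs_pos_eq by nra. ring. }
  assert (Ha2 : (alpha ^ 2)%R <> 0%R) by now apply pow_nonzero.
  unfold signed_curvature. rewrite H1, H2, Hm. split.
  - field. intros Z. apply RtoC_inj in Z. contradiction.
  - assert (HTT : (Re T ^ 2 + Im T ^ 2 = 1)%R) by (rewrite <- Cmod2_alt, HT; ring).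
    transitivity (kappa * (Re T ^ 2 + Im T ^ 2))%R.
    + destruct T as [u v]. cbn. field. exact Ha.
    + rewrite HTT. ring.
Qed.

(** * The biarc *)

(** The hypotheses are the conditions of order 0, 1 and 2 in terms of the
    coefficients.  By the first, the coefficient at the joint is shared: it is
    collected on one side of the second and cancels from the third. *)
Lemma preimage_C2 wA wB k :
  wB 0%nat = wA 3%nat -> 2 * wA 3%nat = wA 2%nat + wB 1%nat ->
  wA 1%nat - 2 * wA 2%nat = wB 2%nat - 2 * wB 1%nat ->
  (k <= 2)%nat ->
  CDerive_n (piece wA 0) k (1 / 2) = CDerive_n (piece wB 1) k (1 / 2).
Proof.
  intros H0 H1 H2 Hk.
  assert (E : (1 / 2 = (0 + 1) / 2)%R) by lra.
  destruct k as [|[|[|k]]]; [| | |lia];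
    rewrite ?(CDerive_n_S (piece _ _) (piece' _ _)) by (intros; apply Cderive_piece);
    rewrite ?(CDerive_n_S (piece' _ _) (piece'' _ _)) by (intros; apply Cderive_piece');
    rewrite !CDerive_n_0;
    rewrite E at 1; rewrite ?piece_start, ?piece_end, ?piece'_start, ?piece'_end,
      ?piece''_start, ?piece''_end, H0.
  - reflexivity.
  - replace (wB 1%nat) with (2 * wA 3%nat - wA 2%nat) by (rewrite H1; ring). ring.
  - replace (wB 2%nat) with (wA 1%nat - 2 * wA 2%nat + 2 * wB 1%nat) by (rewrite H2; ring).
    ring.
Qed.

Lemma biarc_exists wA wB P0 P1 :
  exists rA rB : R -> C, PH_pieces7 wA wB rA rB /\ rA 0%R = P0 /\ rB 1%R = P1.
Proof.
  destruct (polynomial_curve_primitive 6 _ 0 P0 (polynomial_curve_piece_sqr wA 0))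
    as (rA & HA & HA0 & HA').
  destruct (polynomial_curve_primitive 6 _ 1 P1 (polynomial_curve_piece_sqr wB 1))
    as (rB & HB & HB1 & HB').
  exists rA, rB. split; [|split; assumption].
  split; [exact HA|]. split; [exact HB|]. split; [|intros t _; apply HB'].
  intros t _. rewrite preimageA_piece. apply HA'.
Qed.

Theorem theorem1
  (P0 P1 t0 t1 : C) (kappa0 kappa1 : R)
  (ht0 : Cmod t0 = 1%R) (ht1 : Cmod t1 = 1%R)
  (alpha0 alpha1 beta0 beta1 : R)
  (halpha0 : alpha0 <> 0%R) (halpha1 : alpha1 <> 0%R)
  (zeta : R) (hzeta : zeta = 1%R \/ zeta = (-1)%R) :
  let dP := P1 - P0 in
  let n0 := Ci * t0 in
  let n1 := Ci * t1 in
  let wA0 := RtoC alpha0 * chi t0 in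
  let wB3 := RtoC alpha1 * chi t1 in
  let wA1 := 1 / wA0 * (RtoC (alpha0 ^ 2 + beta0 / 12) * t0
                        + RtoC (kappa0 * (alpha0 ^ 4 / 12)) * n0) in
  let wB2 := 1 / wB3 * (RtoC (alpha1 ^ 2 - beta1 / 12) * t1
                        - RtoC (kappa1 * (alpha1 ^ 4 / 12)) * n1) in
  let U := 1 / 52 * (5 * (wA0 + wB3) + 39 * (wA1 + wB2)) in
  let V := 1 / 52 * (40 * (wA0 ^ 2 + wB3 ^ 2) + 49 * (wA0 * wA1 + wB2 * wB3)
                     + 62 * (wA1 ^ 2 + wB2 ^ 2) + wA0 * wB2 + wA1 * wB3
                     + 28 * wA1 * wB2 - 560 * dP) in
  let d := RtoC zeta * chi (U ^ 2 - V) - U in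
  let wA2 := 1 / 2 * (wA1 + d) in
  let wB1 := 1 / 2 * (wB2 + d) in
  let wA3 := 1 / 4 * wA1 + 1 / 2 * d + 1 / 4 * wB2 in
  let wB0 := wA3 in
  let wA := quad wA0 wA1 wA2 wA3 in
  let wB := quad wB0 wB1 wB2 wB3 in
  (exists rA rB : R -> C,
     PH_pieces7 wA wB rA rB /\ rA 0%R = P0 /\ rB 1%R = P1) /\
  (forall rA rB : R -> C,
     PH_pieces7 wA wB rA rB -> rA 0%R = P0 -> rB 1%R = P1 ->
     let r := biarc rA rB in
     let r' := CDerive_n r 1 in
     PH_biarc7 wA wB rA rB /\
     (r 0%R = P0 /\ r 1%R = P1) /\
     (r' 0%R / RtoC (Cmod (r' 0%R)) = t0 /\ r' 1%R / RtoC (Cmod (r' 1%R)) = t1) /\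
     (signed_curvature r 0 = kappa0 /\ signed_curvature r 1 = kappa1)).
Proof.
  intros dP n0 n1 wA0 wB3 wA1 wB2 U V d wA2 wB1 wA3 wB0 wA wB.
  assert (Hchi : forall T, Cmod T = 1%R -> chi T <> 0).
  { intros T HT. apply chi_neq_0. intros Z. rewrite Z, Cmod_0 in HT. lra. }
  assert (HA0 : wA0 <> 0).
  { apply Cmult_neq_0; [intros Z; apply RtoC_inj in Z; contradiction|auto]. }
  assert (HB3 : wB3 <> 0).
  { apply Cmult_neq_0; [intros Z; apply RtoC_inj in Z; contradiction|auto]. }
  assert (HA00 : wA0 ^ 2 = RtoC (alpha0 ^ 2) * t0).
  { apply scaled_chi_sqr. }
  assert (HB33 : wB3 ^ 2 = RtoC (alpha1 ^ 2) * t1).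
  { apply scaled_chi_sqr. }
  assert (HA01 : wA0 * wA1 = RtoC (alpha0 ^ 2 + beta0 / 12) * t0
                        + RtoC (kappa0 * (alpha0 ^ 4 / 12)) * n0).
  { unfold wA1. field. exact HA0. }
  assert (HB23 : wB3 * wB2 = RtoC (alpha1 ^ 2 - beta1 / 12) * t1
                        - RtoC (kappa1 * (alpha1 ^ 4 / 12)) * n1).
  { unfold wB2. field. exact HB3. }
  assert (Hd : d ^ 2 + 2 * U * d + V = 0) by exact (quadratic_root U V zeta hzeta).
  (* The gap left by the two displacements is 52/560 of the quadratic in [d]. *)
  assert (Hgap : hodograph_integral wA + hodograph_integral wB = dP).
  { transitivity (dP + 52 / 560 * (d ^ 2 + 2 * U * d + V)).
    - unfold hodograph_integral, wA, wB, quad. cbn [nth]. unfold wB0, wA3, wA2, wB1, U, V.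
      field.
    - rewrite Hd. ring. }
  split; [apply biarc_exists|].
  intros rA rB HPH HP0 HP1 r r'. destruct HPH as (HpA & HpB & HdA & HdB).
  assert (HdA' : forall t, (0 / 2 <= t <= (0 + 1) / 2)%R -> Cderive rA t (piece wA 0 t ^ 2)).
  { intros t Ht. rewrite <- preimageA_piece. apply HdA. lra. }
  assert (HdB' : forall t, (1 / 2 <= t <= (1 + 1) / 2)%R -> Cderive rB t (piece wB 1 t ^ 2)).
  { intros t Ht. apply HdB. lra. }
  assert (Hr0 : locally 0%R (fun t => r t = rA t)).
  { apply (locally_interval _ 0 m_infty (1 / 2)%R); [exact I|cbn; lra|].
    intros t _ Ht. unfold r, biarc. destruct (Rlt_dec t (1 / 2)); [reflexivity|].
    cbn in Ht. contradiction. }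
  assert (Hr1 : locally 1%R (fun t => r t = rB t)).
  { apply (locally_interval _ 1 (1 / 2)%R p_infty); [cbn; lra|exact I|].
    intros t Ht _. unfold r, biarc. destruct (Rlt_dec t (1 / 2)); [|reflexivity].
    cbn in Ht. lra. }
  assert (Hjoin : rA (1 / 2)%R = rB (1 / 2)%R).
  { pose proof (piece_displacement wA 0 rA HdA') as EA.
    pose proof (piece_displacement wB 1 rB HdB') as EB.
    replace (0 / 2)%R with 0%R in EA by field.
    replace ((0 + 1) / 2)%R with (1 / 2)%R in EA by field.
    replace ((1 + 1) / 2)%R with 1%R in EB by field.
    rewrite HP0 in EA. rewrite HP1 in EB.
    replace (rA (1 / 2)%R) with (hodograph_integral wA + P0) by (rewrite <- EA; ring).
    replace (rB (1 / 2)%R) with (P1 - hodograph_integral wB) by (rewrite <- EB; ring).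
    replace (hodograph_integral wB) with (dP - hodograph_integral wA)
      by (rewrite <- Hgap; ring).
    unfold dP. ring. }
  assert (H0 : r' 0%R / RtoC (Cmod (r' 0%R)) = t0 /\ signed_curvature r 0 = kappa0).
  { destruct (derivatives_at_start 5 wA 0 rA r 0 ltac:(lra) HpA HdA' Hr0) as [D1 D2].
    apply (tangent_curvature r 0 alpha0 beta0); auto.
    - rewrite D1. exact HA00.
    - rewrite D2. change (12 * (wA0 * wA1) - 12 * wA0 ^ 2
        = RtoC beta0 * t0 + RtoC (kappa0 * alpha0 ^ 4) * n0).
      rewrite HA01, HA00.
      rewrite ?RtoC_plus, ?RtoC_mult, ?RtoC_div, ?RtoC_pow by lra. field. }
  assert (H1 : r' 1%R / RtoC (Cmod (r' 1%R)) = t1 /\ signed_curvature r 1 = kappa1).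
  { destruct (derivatives_at_end 5 wB 1 rB r 1 ltac:(lra) HpB HdB' Hr1) as [D1 D2].
    apply (tangent_curvature r 1 alpha1 beta1); auto.
    - rewrite D1. exact HB33.
    - rewrite D2. change (12 * wB3 ^ 2 - 12 * (wB3 * wB2)
        = RtoC beta1 * t1 + RtoC (kappa1 * alpha1 ^ 4) * n1).
      rewrite HB23, HB33.
      rewrite ?RtoC_minus, ?RtoC_mult, ?RtoC_div, ?RtoC_pow by lra. field. }
  split; [|split; [|tauto]].
  - split; [split; [exact HpA|split; [exact HpB|split; [exact HdA|exact HdB]]]|].
    split; [|exact Hjoin].
    intros k Hk.
    transitivity (CDerive_n (piece wA 0) k (1 / 2)).
    { apply CDerive_n_ext_loc, filter_forall. intros t. apply preimageA_piece. }
    apply (preimage_C2 wA wB k); [reflexivity| | |exact Hk];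
      unfold wA, wB, quad; cbn [nth]; unfold wB0, wA3, wA2, wB1; field.
  - unfold r, biarc.
    destruct (Rlt_dec 0 (1 / 2)); [|lra]. destruct (Rlt_dec 1 (1 / 2)); [lra|]. auto.
Qed.
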